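(* Let $\mathbb{K}$ be a field of characteristic zero, let $\sigma\subset\mathbb{R}^n$ be a strongly convex rational cone containing the first orthant ${\mathbb{R}_{\ge0}}^n$, and let $\xi\in\mathbb{K}[[\sigma]]_{x_1\cdots x_n}\setminus\mathbb{K}[[x]]_{x_1\cdots x_n}$ be algebraic over $\mathbb{K}[[x]]$. Then there exist a strongly convex rational cone $\sigma'\subset\sigma$ containing the first orthant with $\xi\in\mathbb{K}[[\sigma']]_{x_1\cdots x_n}$, a vector $\omega$ in the interior of the dual cone $\sigma'^\vee$, and a constant $b\in\mathbb{R}$ such that for all $g\in\mathbb{K}[[x]]$ and all $\beta\in{\mathbb{Z}_{\ge0}}^n$ $$\nu_\omega\left(\xi-\frac{g}{x^\beta}\right)\le\omega\cdot\beta+b,$$ or equivalently $$\left|\xi-\frac{g}{x^\beta}\right|_{\nu_\omega}\ge C\,|x^\beta|_{\nu_\omega},\qquad C=e^{-b}.$$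
   Context: A (polyhedral) cone in $\mathbb{R}^n$ is the set of nonnegative real combinations of finitely many vectors; it is rational if the generators can be chosen in $\mathbb{Z}^n$, and strongly convex if it contains no nonzero linear subspace. The dual of $\sigma$ is $\sigma^\vee=\{v\in\mathbb{R}^n : v\cdot u\ge0\ \forall u\in\sigma\}$. $x=(x_1,\dots,x_n)$. A Laurent series is a formal sum $\xi=\sum_{\alpha\in\mathbb{Z}^n}\xi_\alpha x^\alpha$ with $\xi_\alpha\in\mathbb{K}$ and $\operatorname{Supp}(\xi)=\{\alpha : \xi_\alpha\neq0\}$. For a strongly convex rational cone $\sigma$, $\mathbb{K}[[\sigma]]$ is the ring of Laurent series with support in $\sigma\cap\mathbb{Z}^n$ (Cauchy product). If $\sigma\supset{\mathbb{R}_{\ge0}}^n$, $\mathbb{K}[[\sigma]]_{x_1\cdots x_n}$ is the localization by the powers of $x_1\cdots x_n$, i.e. the ring of Laurent series with support in $\gamma+\sigma$ for some $\gamma\in\mathbb{Z}^n$; $\mathbb{K}[[x]]_{x_1\cdots x_n}$ is the case $\sigma={\mathbb{R}_{\ge0}}^n$. ''Algebraic over $\mathbb{K}[[x]]$'' means: root of a nonzero polynomial with coefficients in $\mathbb{K}[[x]]$. For a nonzero $\eta\in\mathbb{K}[[\sigma']]_{x_1\cdots x_n}$ and $\omega\in\sigma'^\vee$, $\nu_\omega(\eta)=\min\{\omega\cdot\alpha : \alpha\in\operatorname{Supp}(\eta)\}$ (this minimum exists) and $|\eta|_{\nu_\omega}=e^{-\nu_\omega(\eta)}$. *)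

(* Defs.v *)
From HB Require Import structures.
From mathcomp Require Import all_boot all_order all_algebra.
From mathcomp Require Import all_classical all_reals all_analysis.

Set Implicit Arguments.
Unset Strict Implicit.
Unset Printing Implicit Defensive.

Import Order.TTheory GRing.Theory Num.Theory.
Import numFieldNormedType.Exports.

Local Open Scope classical_set_scope.
Local Open Scope ring_scope.

Section Cones.
Variables (R : realType) (n : nat).

Definition dotp (u v : 'rV[R]_n) : R := \sum_i u 0 i * v 0 i.

Definition toR (a : 'rV[int]_n) : 'rV[R]_n := map_mx intr a.

Definition cone_gen (s : seq 'rV[R]_n) : set 'rV[R]_n :=
  [set v | exists2 c : 'I_(size s) -> R,
     (forall i, 0 <= c i) & v = \sum_i c i *: s`_i].

Definition rational_cone (sigma : set 'rV[R]_n) : Prop :=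
  exists s : seq 'rV[int]_n, sigma = cone_gen (map toR s).

Definition strongly_convex (sigma : set 'rV[R]_n) : Prop :=
  forall V : {vspace 'rV[R]_n}, [set` V] `<=` sigma -> V = 0%VS.

Definition dual_cone (sigma : set 'rV[R]_n) : set 'rV[R]_n :=
  [set v | forall u, sigma u -> 0 <= dotp v u].

Definition orthant : set 'rV[R]_n := [set v | forall i, 0 <= v 0 i].

End Cones.

Arguments orthant : clear implicits.

Section LaurentSeries.
Variables (K : fieldType) (n : nat).

(* The series is the family of its coefficients.  Sums and differences are
   pointwise ([\+], [\-]); beware that the product is [lmul] and not the
   pointwise product of functions. *)
Definition laurent := 'rV[int]_n -> K.

Definition supp (xi : laurent) : set 'rV[int]_n := [set a | xi a != 0].

Definition lmono (b : 'rV[int]_n) : laurent := fun a => (a == b)%:R.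

(* Cauchy product.  [\sum_(b \in A)] is the sum over the b where the summand is
   nonzero, and is 0 by convention if there are infinitely many of them.  There
   are only finitely many when both supports lie in translates of one
   strongly convex polyhedral cone. *)
Definition lmul (xi eta : laurent) : laurent :=
  fun a => \sum_(b \in [set: 'rV[int]_n]) (xi b * eta (a - b)).

Definition lexp (xi : laurent) (k : nat) : laurent :=
  iter k (lmul xi) (lmono 0).

(* g / x^b *)
Definition ldivX (g : laurent) (b : 'rV[int]_n) : laurent :=
  lmul g (lmono (- b)).

Variable R : realType.

Definition cone_series (sigma : set 'rV[R]_n) : set laurent :=
  [set xi | forall a, supp xi a -> sigma (toR R a)].

(* The localization of K[[sigma]] by the powers of x_1 ... x_n, as the series
   supported in some translate c + sigma. *)
Definition cone_series_loc (sigma : set 'rV[R]_n) : set laurent :=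
  [set xi | exists c : 'rV[int]_n,
     forall a, supp xi a -> sigma (toR R (a - c))].

(* P 0, ..., P d are the coefficients of the polynomial. *)
Definition algebraic_over_power_series (xi : laurent) : Prop :=
  exists (d : nat) (P : 'I_d.+1 -> laurent),
    [/\ forall i, cone_series (orthant R n) (P i),
        exists i, exists a, P i a != 0
      & forall a, \sum_(i < d.+1) lmul (P i) (lexp xi i) a = 0].

(* The minimum of [values] when it exists (otherwise 0). *)
Definition nu (w : 'rV[R]_n) (eta : laurent) : R :=
  let values := [set dotp w (toR R a) | a in supp eta] in
  xget 0 (values `&` lbound values).

Definition abs_nu (w : 'rV[R]_n) (eta : laurent) : R := expR (- nu w eta).

End LaurentSeries.

(* Main.v *)
Require Import Defs.
From HB Require Import structures.
From mathcomp Require Import all_boot all_order all_algebra.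
From mathcomp Require Import all_classical all_reals all_analysis.
From mathcomp Require Import zify ring.

(** Subtracting g / x^beta cannot cancel a term of xi whose exponent a has some
    a_j < - beta_j.  So it suffices to find w and b such that for every
    beta >= 0 the support of xi has such an a with w.a <= w.beta + b.

    Let A be the support of xi and choose an integer vector q >= 0 with A + q
    inside sigma and q >= p for some exponent p of the leading coefficient P_D of
    the equation of xi.  Some weight w1 in the interior of the dual of sigma is
    nonnegative on A + q, and, as xi is not in the localization of K[[x]], some
    positive weight w2 is not.  On a fine subdivision of [w1, w2] there are
    consecutive weights h, w' such that h is nonnegative on A + q and w' is not.
    Take sigma' = sigma /\ {h >= 0} and w = h + w1; w and w' are relatively
    close.

    If some beta admits no a as above, the truncation Q of xi to weights
    w.a <= w.beta + b has all its exponents >= - beta.  Since P(xi) = 0, the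
    exponents m of P(Q) satisfy w.m > w.beta + b - const.  For the weight w',
    however, xi is negative enough for P_D Q^D to contain the lowest term of P(Q).
    Its exponent is e + D a with e in Supp(P_D) bounded and a in Supp(Q), whence
    D (w.a) > w.beta.  But w'.a < 0 and a >= - beta bound a linearly in beta, so
    that w.a, being close to w'.a < 0, is at most w.beta / (D + 1). *)

Set Implicit Arguments.
Unset Strict Implicit.
Unset Printing Implicit Defensive.

Import Order.TTheory GRing.Theory Num.Theory.
Import numFieldNormedType.Exports.

Local Open Scope classical_set_scope.
Local Open Scope ring_scope.

(** * Dot products over a commutative ring *)

(** Generalises [dotp], to which it is convertible over R, so that weights and exponents can be
    paired over the integers. *)
Definition rdot (S : comPzRingType) n (u v : 'rV[S]_n) : S :=
  \sum_i u 0 i * v 0 i.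

Section Rdot.
Variables (S : comPzRingType) (n : nat).
Implicit Types u v : 'rV[S]_n.

Lemma rdotDl u1 u2 v : rdot (u1 + u2) v = rdot u1 v + rdot u2 v.
Proof.
by rewrite /rdot -big_split; apply: eq_bigr => i _; rewrite mxE mulrDl.
Qed.

Lemma rdotC u v : rdot u v = rdot v u.
Proof. by apply: eq_bigr => i _; rewrite mulrC. Qed.

Lemma rdotZl c u v : rdot (c *: u) v = c * rdot u v.
Proof. by rewrite /rdot mulr_sumr; apply: eq_bigr => i _; rewrite mxE mulrA. Qed.

Lemma rdotDr u v1 v2 : rdot u (v1 + v2) = rdot u v1 + rdot u v2.
Proof. by rewrite !(rdotC u) rdotDl. Qed.

Lemma rdotZr c u v : rdot u (c *: v) = c * rdot u v.
Proof. by rewrite !(rdotC u) rdotZl. Qed.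

Lemma rdot0r u : rdot u 0 = 0.
Proof. by rewrite -(scale0r (0 : 'rV_n)) rdotZr mul0r. Qed.

Lemma rdotNr u v : rdot u (- v) = - rdot u v.
Proof. by rewrite -scaleN1r rdotZr mulN1r. Qed.

Lemma rdotBr u v1 v2 : rdot u (v1 - v2) = rdot u v1 - rdot u v2.
Proof. by rewrite rdotDr rdotNr. Qed.

Lemma rdotBl u1 u2 v : rdot (u1 - u2) v = rdot u1 v - rdot u2 v.
Proof. by rewrite !(rdotC _ v) rdotBr. Qed.

Lemma rdotMnr u v k : rdot u (v *+ k) = k%:R * rdot u v.
Proof. by rewrite -(scaler_nat k v) rdotZr. Qed.

Lemma rdot_sumr (I : finType) (P : pred I) u (F : I -> 'rV[S]_n) :
  rdot u (\sum_(i | P i) F i) = \sum_(i | P i) rdot u (F i).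
Proof. by apply: (big_morph _ (rdotDr u) (rdot0r u)). Qed.

Lemma rdot_delta i v : rdot (delta_mx 0 i) v = v 0 i.
Proof.
rewrite /rdot (bigD1 i) //= big1 => [|j ji].
  by rewrite mxE !eqxx mul1r addr0.
by rewrite mxE eqxx (negPf ji) mul0r.
Qed.

Lemma rdot_const1 v : rdot (const_mx 1) v = \sum_i v 0 i.
Proof. by apply: eq_bigr => i _; rewrite mxE mul1r. Qed.

End Rdot.

Lemma rdot_ge0 (S : realDomainType) n (u v : 'rV[S]_n) :
  (forall i, 0 <= u 0 i) -> (forall i, 0 <= v 0 i) -> 0 <= rdot u v.
Proof. by move=> u0 v0; apply: sumr_ge0 => i _; apply: mulr_ge0. Qed.

Lemma rdot_self_gt0 (S : realDomainType) n (u : 'rV[S]_n) :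
  u != 0 -> 0 < rdot u u.
Proof.
move=> u0; have sq0 (i : 'I_n) : true -> 0 <= u 0 i * u 0 i.
  by move=> _; rewrite -expr2 sqr_ge0.
rewrite lt0r sumr_ge0 // andbT; apply: contraNneq u0 => /psumr_eq0P u0.
apply/eqP/rowP => i; rewrite mxE; apply/eqP.
by rewrite -sqrf_eq0 expr2 u0.
Qed.

(** * Minima over sets of exponents, lexicographic order *)

Lemma int_attains_min (T : Type) (A : set T) (f : T -> int) (lb : int) :
  A !=set0 -> (forall a, A a -> lb <= f a) ->
  exists2 e, A e & forall a, A a -> f e <= f a.
Proof.
move=> [a0 Aa0] flb.
have hex : exists m : nat, `[<exists2 a, A a & f a = lb + m%:Z>].
  exists `|f a0 - lb|%N; apply/asboolP; exists a0 => //.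
  by have := flb _ Aa0; lia.
case: (ex_minnP hex) => m /asboolP [e Ae fe] min.
exists e => // a Aa; have lba := flb _ Aa.
have : (m <= `|f a - lb|)%N.
  by apply: min; apply/asboolP; exists a => //; lia.
by rewrite fe; lia.
Qed.

Section LexOrder.
Variable n : nat.
Implicit Types (ws : seq 'rV[int]_n) (a b c e : 'rV[int]_n).

(* For ws containing the coordinate vectors, [lex_ge0 ws (b - a)] is a total group
   order on Z^n, comparing first the values of the head of ws.  It makes the lowest
   term of a product the product of the lowest terms. *)
Fixpoint lex_ge0 ws c : bool :=
  if ws is w :: ws' then
    (0 < rdot w c) || ((rdot w c == 0) && lex_ge0 ws' c)
  else true.

Lemma lex_ge0_head w ws c : lex_ge0 (w :: ws) c -> 0 <= rdot w c.
Proof. by case/orP => [/ltW|/andP[/eqP -> _]]. Qed.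

Lemma lex_ge0D ws a b : lex_ge0 ws a -> lex_ge0 ws b -> lex_ge0 ws (a + b).
Proof.
elim: ws => //= w ws IH; rewrite rdotDr.
case/orP => [wa|/andP[/eqP -> la]]; case/orP => [wb|/andP[/eqP -> lb]].
- by rewrite addr_gt0.
- by rewrite addr0 wa.
- by rewrite add0r wb.
- by rewrite addr0 eqxx IH // orbT.
Qed.

(** Both signs being nonnegative, every comparison is a tie. With the coordinate vectors in [ws]
    this gives c = 0. *)
Lemma lex_ge0_anti ws c w :
  lex_ge0 ws c -> lex_ge0 ws (- c) -> w \in ws -> rdot w c = 0.
Proof.
elim: ws => //= v ws IH; rewrite rdotNr.
case/orP => [vc|/andP[/eqP vc lc]]; case/orP => [vc'|/andP[/eqP vc' lc']];
  rewrite inE => /orP[/eqP ->|wws]; first [lia|exact: IH].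
Qed.

(** Minimise the first weight, then recurse on the set of its minimisers. *)
Lemma lex_attains_min ws (A : set 'rV[int]_n) :
  A !=set0 ->
  (forall w, w \in ws -> exists lb, forall a, A a -> lb <= rdot w a) ->
  exists2 e, A e & forall a, A a -> lex_ge0 ws (a - e).
Proof.
elim: ws A => [|w ws IH] A A0 bnd; first by case: A0 => e Ae; exists e.
have [lb lbP] : exists lb, forall a, A a -> lb <= rdot w a.
  by apply: bnd; rewrite mem_head.
have [e1 Ae1 min1] := int_attains_min A0 lbP.
have [||e [Ae we] min] := IH (A `&` [set a | rdot w a = rdot w e1]).
- by exists e1.
- move=> v vws; have [|lv lvP] := bnd v; first by rewrite inE vws orbT.
  by exists lv => a [/lvP].
exists e => // a Aa /=; rewrite rdotBr we subr_gt0 subr_eq0.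
have := min1 _ Aa; rewrite le_eqVlt eq_sym => /orP[wa|->//].
by rewrite wa min ?orbT //; split => //; apply/eqP.
Qed.

End LexOrder.

(** * Cauchy products: lowest terms, powers and truncation *)

Section CauchyProduct.
Variables (K : fieldType) (n : nat).
Implicit Types (f g : laurent K n) (a b : 'rV[int]_n).

Lemma lmul_neq0 f g a :
  lmul f g a != 0 -> exists2 b, f b != 0 & g (a - b) != 0.
Proof.
move=> fga; apply: contrapT => nex; case/negP: fga; apply/eqP.
apply: fsbig1 => b _; apply/eqP; rewrite mulf_eq0.
apply: contrapT => /negP; rewrite negb_or => /andP[fb gb].
by apply: nex; exists b.
Qed.

(* No finiteness assumption: the two sums agree term by term. *)
Lemma eq_lmul f f' g g' a :
  (forall b, f b * g (a - b) = f' b * g' (a - b)) ->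
  lmul f g a = lmul f' g' a.
Proof. by move=> h; apply: eq_fsbigr => b _. Qed.

Lemma lmul_one_term f g a b0 :
  (forall b, f b != 0 -> g (a - b) != 0 -> b = b0) ->
  lmul f g a = f b0 * g (a - b0).
Proof.
move=> h; rewrite /lmul -(fsbig_widen [set b0]) //; first by rewrite fsbig_set1.
move=> b [_ /= bb0]; apply/eqP; apply: contrapT => /negP.
by rewrite mulf_eq0 negb_or => /andP[fb gb]; apply: bb0; apply: h.
Qed.

Lemma ldivXE f b a : ldivX f b a = f (a + b).
Proof.
rewrite /ldivX (lmul_one_term (b0 := a + b)) => [|c _].
  by rewrite /lmono opprD addrA subrr add0r eqxx mulr1.
rewrite /lmono; case: (a - c =P - b) => [ac _|_ /eqP //].
by rewrite -(opprK b) -ac opprB addrC subrK.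
Qed.

Definition lex_lead (ws : seq 'rV[int]_n) f e : Prop :=
  f e != 0 /\ forall a, f a != 0 -> lex_ge0 ws (a - e).

(** If b contributes to the coefficient at e1 + e2, then b - e1 and its opposite are both
    nonnegative, so b = e1: that coefficient is a single nonzero product. *)
Lemma lex_lead_lmul ws f g e1 e2 :
  (forall i, delta_mx 0 i \in ws) ->
  lex_lead ws f e1 -> lex_lead ws g e2 -> lex_lead ws (lmul f g) (e1 + e2).
Proof.
move=> wsb [fe1 min1] [ge2 min2]; split.
  rewrite (lmul_one_term (b0 := e1)) => [|b /min1 l1 /min2 l2].
    by rewrite addrAC subrr add0r mulf_neq0.
  apply/eqP; rewrite -subr_eq0; apply/eqP/rowP => i.
  rewrite -rdot_delta [RHS]mxE; apply: lex_ge0_anti l1 _ (wsb i).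
  by congr lex_ge0: l2; rewrite addrAC addrK opprB.
move=> a /lmul_neq0 [b /min1 l1 /min2 l2].
by congr lex_ge0: (lex_ge0D l1 l2);
  rewrite addrC addrA (addrAC _ (- e2)) subrK opprD addrA [RHS]addrAC.
Qed.

Lemma lex_lead_lexp ws f e k :
  (forall i, delta_mx 0 i \in ws) ->
  lex_lead ws f e -> lex_lead ws (lexp f k) (e *+ k).
Proof.
move=> wsb lf; elim: k => [|k IH] /=; last by rewrite mulrS; apply: lex_lead_lmul.
rewrite mulr0n /lmono; split => [|a]; first by rewrite eqxx oner_neq0.
case: (a =P 0) => [-> _|_ /eqP //].
rewrite subrr; elim: {+}ws => //= w vs IHv.
by rewrite rdot0r eqxx IHv orbT.
Qed.

Lemma lexp_lower_bound (w : 'rV[int]_n) f (r : int) k a :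
  (forall b, f b != 0 -> r <= rdot w b) ->
  lexp f k a != 0 -> r *+ k <= rdot w a.
Proof.
move=> fr; elim: k a => [|k IH] a /=.
  by rewrite /lmono; case: (a =P 0) => [->|_ /eqP //]; rewrite rdot0r.
case/lmul_neq0 => b /fr rb /IH; rewrite rdotBr mulrS; lia.
Qed.

Definition truncate (w : 'rV[int]_n) (c : int) f : laurent K n :=
  fun a => if rdot w a <= c then f a else 0.

Lemma truncate_neq0 w c f a :
  truncate w c f a != 0 -> rdot w a <= c /\ f a != 0.
Proof. by rewrite /truncate; case: ifP => // _ /eqP. Qed.

(** A discarded term has weight above c and each other factor has weight at least - r, so products
    involving it have weight above c - r k. *)
Lemma lexp_truncate w c f (r : int) k a :
  0 <= r -> (forall b, f b != 0 -> - r <= rdot w b) ->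
  rdot w a <= c - r *+ k ->
  lexp (truncate w c f) k a = lexp f k a.
Proof.
move=> r0 fr; elim: k a => [//|k IH] a /=; rewrite mulrS => ac.
apply: eq_lmul => b.
have [fb|/fr rb] := eqVneq (f b) 0.
  by rewrite /truncate fb if_same !mul0r.
rewrite IH; last by rewrite rdotBr; lia.
have [->|] := eqVneq (lexp f k (a - b)) 0; first by rewrite !mulr0.
move/(lexp_lower_bound fr); rewrite rdotBr mulNrn => ge.
by rewrite /truncate ifT //; lia.
Qed.

End CauchyProduct.

(* On a >= - beta, the relation w'.a <= 0 bounds [\sum_j w'_j * |a_j|] by twice
   w'.beta. *)
Lemma close_weights n (w w' a beta : 'rV[int]_n) (k : nat) :
  (0 < k)%N ->
  (forall j, (4 * k)%:Z * `|w 0 j - w' 0 j| <= w' 0 j) ->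
  (forall j, 0 <= beta 0 j) -> (forall j, - beta 0 j <= a 0 j) ->
  rdot w' a <= 0 -> k%:Z * rdot w a <= rdot w beta.
Proof.
move=> k0 close beta0 abeta w'a.
have w'0 j : 0 <= w' 0 j by rewrite (le_trans _ (close j)) // mulr_ge0.
have ua : (4 * k)%:Z * rdot (w - w') a <= rdot w' (a + (beta + beta)).
  rewrite -rdotZl; apply: ler_sum => j _; rewrite !mxE -mulrA.
  apply: (@le_trans _ _ ((4 * k)%:Z * (`|w 0 j - w' 0 j| * `|a 0 j|))).
    by rewrite ler_wpM2l // -normrM ler_norm.
  rewrite mulrA (le_trans (ler_wpM2r _ (close j))) //.
  rewrite ler_wpM2l // ler_norml; have := beta0 j; have := abeta j.
  by move: (a 0 j) (beta 0 j) => x y; lia.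
have ub : (4 * k)%:Z * rdot (w' - w) beta <= rdot w' beta.
  rewrite -rdotZl; apply: ler_sum => j _; rewrite !mxE ler_wpM2r //.
  by rewrite (le_trans _ (close j)) // ler_wpM2l // distrC ler_norm.
have w'b : 0 <= rdot w' beta.
  by apply: rdot_ge0.
have {ub} w'b2 : rdot w' beta <= 2 * rdot w beta.
  have [|ltb] := lerP (rdot w' beta) (rdot w beta); first lia.
  have : 4 * (rdot w' beta - rdot w beta) <= rdot w' beta.
    apply: le_trans ub; rewrite rdotBl ler_wpM2r ?subr_ge0 ?(ltW ltb) //.
    lia.
  lia.
have kw'a : k%:Z * rdot w' a <= 0 by rewrite mulr_ge0_le0.
(* In total, 4k w.a <= (4k + 1) w'.a + 2 w'.beta <= 2 w'.beta <= 4 w.beta. *)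
move: ua; rewrite PoszM -mulrA rdotBl mulrBr !rdotDr; lia.
Qed.

(** * The Liouville-type bound on the support *)

Section Liouville.
Variables (K : fieldType) (n d : nat) (P : 'I_d.+1 -> laurent K n).
Variables (xi : laurent K n) (D : 'I_d.+1) (p q w w' a0 : 'rV[int]_n).
Hypothesis P_orthant : forall i a, P i a != 0 -> forall j, 0 <= a 0 j.
Hypothesis P_root : forall a, \sum_(i < d.+1) lmul (P i) (lexp xi i) a = 0.
Hypothesis P_top : forall i : 'I_d.+1, (D < i)%N -> forall a, P i a = 0.
Hypothesis P_p : P D p != 0.
Hypothesis p_le_q : forall j, p 0 j <= q 0 j.
Hypothesis w_gt0 : forall j, 0 < w 0 j.
Hypothesis w'_gt0 : forall j, 0 < w' 0 j.
Hypothesis w_close : forall j, (4 * D.+1)%:Z * `|w 0 j - w' 0 j| <= w' 0 j.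
Hypothesis xi_w : forall a, xi a != 0 -> 0 <= rdot w (a + q).
Hypothesis xi_a0 : xi a0 != 0.
Hypothesis a0_w' : rdot w' (a0 + q) < 0.

(* Ties for the weight w' are broken by the coordinates. *)
Let ws := w' :: [seq delta_mx 0 i | i <- enum 'I_n].

Let ws_delta i : delta_mx 0 i \in ws.
Proof. by rewrite inE map_f ?orbT // mem_enum. Qed.

(** All vectors of [ws] have nonnegative entries, so a lower bound on the exponents bounds each of
    these weights. *)
Lemma lex_lead_bounded_below (f : laurent K n) (beta a : 'rV[int]_n) :
  (forall a j, f a != 0 -> - beta 0 j <= a 0 j) -> f a != 0 ->
  exists e, lex_lead ws f e.
Proof.
move=> fbeta fa.
have [||e fe le_e] := @lex_attains_min n ws [set a | f a != 0].
- by exists a.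
- move=> v; rewrite inE => /orP[/eqP ->|/mapP [i _ ->]].
    exists (rdot w' (- beta)) => b fb; rewrite -subr_ge0 -rdotBr.
    apply: rdot_ge0 => j; first exact: ltW.
    by rewrite !mxE opprK -lerBlDr sub0r fbeta.
  by exists (- beta 0 i) => b /fbeta; rewrite rdot_delta.
by exists e.
Qed.

Let P_w i b : P i b != 0 -> 0 <= rdot w b.
Proof. by move=> /P_orthant b0; apply: rdot_ge0 => // j; apply: ltW. Qed.

Let P_w' i b : P i b != 0 -> 0 <= rdot w' b.
Proof. by move=> /P_orthant b0; apply: rdot_ge0 => // j; apply: ltW. Qed.

Lemma support_leaves_orthants :
  exists b : int, forall beta : 'rV[int]_n, (forall j, 0 <= beta 0 j) ->
  exists a, [/\ xi a != 0, exists j, a 0 j < - beta 0 j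
              & rdot w a <= rdot w beta + b].
Proof.
have [e le] : exists e, lex_lead ws (P D) e.
  apply: (@lex_lead_bounded_below _ 0 p) => // a j /P_orthant.
  by rewrite mxE oppr0.
have q0 j : 0 <= q 0 j by apply: le_trans (p_le_q j); apply: P_orthant P_p j.
have wq0 : 0 <= rdot w q by apply: rdot_ge0 => // j; apply: ltW.
have xi_wq a : xi a != 0 -> - rdot w q <= rdot w a.
  by move/xi_w; rewrite rdotDr; lia.
(* The first summand pays for truncating in powers up to D, the second for the exponent e of P_D,
   and the third keeps a0 in the truncation. *)
exists (rdot w q *+ D + rdot w e + `|rdot w a0|) => beta beta0.
set c := rdot w beta + _.
have wb0 : 0 <= rdot w beta by apply: rdot_ge0 => // j; apply: ltW.
have we0 : 0 <= rdot w e by apply: P_w (proj1 le).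
have wqD0 : 0 <= rdot w q *+ D by rewrite mulrn_wge0.
apply: contrapT => nex.
have Qbeta a j : truncate w c xi a != 0 -> - beta 0 j <= a 0 j.
  case/truncate_neq0 => ac xia; rewrite leNgt; apply/negP => aj.
  by apply: nex; exists a; split => //; exists j.
have Qa0 : truncate w c xi a0 != 0 by rewrite /truncate ifT // /c; lia.
have [alpha lalpha] := lex_lead_bounded_below Qbeta Qa0.
have w'alpha : rdot w' alpha < - rdot w' q.
  have /lex_ge0_head := proj2 lalpha _ Qa0; move: a0_w'.
  by rewrite rdotDr rdotBr; lia.
have w'pq : rdot w' p <= rdot w' q.
  rewrite -subr_ge0 -rdotBr; apply: rdot_ge0 => j; first exact: ltW.
  by rewrite !mxE subr_ge0.
have w'p0 := P_w' P_p.
pose m := e + alpha *+ D.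
have lead_m := lex_lead_lmul ws_delta le (lex_lead_lexp D ws_delta lalpha).
have w'm : rdot w' m <= rdot w' p + D%:Z * rdot w' alpha.
  have /lex_ge0_head := proj2 le _ P_p.
  by rewrite /m rdotBr rdotDr rdotMnr natz; lia.
(* For i < D, exponents of P_i Q^i have w'-weight at least i w'.alpha, whereas w'.m <= w'.q + D
   w'.alpha < (D - 1) w'.alpha, with w'.alpha < 0. Hence only P_D Q^D reaches m. *)
have PQm : \sum_(i < d.+1) lmul (P i) (lexp (truncate w c xi) i) m != 0.
  rewrite (bigD1 D) //= big1 ?addr0; first exact: (proj1 lead_m).
  move=> i iD; apply/eqP/negPn/negP => /lmul_neq0 [b Pib Qb].
  have [Di|iD'] := ltnP D i; first by rewrite P_top ?eqxx in Pib.
  have {iD iD'} iD : (i < D)%N by rewrite ltn_neqAle iD iD'.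
  have := P_w' Pib.
  have : rdot w' alpha *+ i <= rdot w' (m - b).
    apply: lexp_lower_bound Qb => a' Qa'.
    by have /lex_ge0_head := proj2 lalpha _ Qa'; rewrite rdotBr; lia.
  rewrite rdotBr -mulr_natr natz; nia.
(* Otherwise truncation does not affect the coefficient at m, and P(Q) has there the coefficient 0
   of P(xi). *)
have wm : c - rdot w q *+ D < rdot w m.
  rewrite ltNge; apply/negP => wm; case/eqP: PQm; rewrite -[RHS](P_root m).
  apply: eq_bigr => i _; apply: eq_lmul => b.
  have [->|Pib] := eqVneq (P i b) 0; first by rewrite !mul0r.
  have [Di|iD] := ltnP D i; first by rewrite P_top // !mul0r.
  congr (_ * _); apply: (lexp_truncate wq0) => //.
  have := P_w Pib; have := ler_wpMn2l wq0 iD; rewrite rdotBr; lia.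
have : (D.+1)%:Z * rdot w alpha <= rdot w beta.
  apply: (@close_weights _ _ w') => //.
  - by move=> j; apply: Qbeta (proj1 lalpha).
  - by have := P_w' P_p; lia.
(* Here w.beta < D w.alpha and (D + 1) w.alpha <= w.beta, with w.beta >= 0, are incompatible. *)
move: wm; rewrite /m /c rdotDr rdotMnr natz; nia.
Qed.

End Liouville.

(** * Gordan's alternative over the integers *)

Section Gordan.
Variable n : nat.

(** Adding a to M y makes the value at a equal to a.a > 0; since y.s_i >= 1 by integrality, M >
    |a.s_i| keeps the others positive. *)
Lemma perturb_separator m (y a : 'rV[int]_n) (s : 'I_m -> 'rV[int]_n) :
  a != 0 -> rdot y a = 0 -> (forall i, 0 < rdot y (s i)) ->
  exists z, 0 < rdot z a /\ forall i, 0 < rdot z (s i).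
Proof.
move=> a0 ya ys; pose M := 1 + \sum_i `|rdot a (s i)|.
exists (M *: y + a); split => [|i].
  by rewrite rdotDl rdotZl ya mulr0 add0r rdot_self_gt0.
rewrite rdotDl rdotZl.
have Mge : `|rdot a (s i)| < M.
  by rewrite /M (bigD1 i) //= ltr_pwDl // lerDl sumr_ge0.
have M1 : M <= M * rdot y (s i).
  by rewrite ler_peMr ?(le_trans _ (ltW Mge)) // -gtz0_ge1 ys.
by move: Mge; rewrite ltr_norml => /andP[]; lia.
Qed.

(* Induction on m: if y separates all the vectors but a := v ord0, then either y can
   be corrected by a, or a positive combination of y and a separator of the
   projections of the other vectors to y^\perp along a is orthogonal to a. *)
Lemma gordan m (v : 'I_m -> 'rV[int]_n) :
  (exists y, forall i, 0 < rdot y (v i)) \/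
  (exists c : 'I_m -> int,
     [/\ forall i, 0 <= c i, exists i, 0 < c i & \sum_i c i *: v i = 0]).
Proof.
elim: m v => [|m IH] v; first by left; exists 0; case.
pose a := v ord0; pose s i := v (lift ord0 i).
have dep (c0 : int) (c : 'I_m -> int) :
    0 <= c0 -> (forall i, 0 <= c i) -> 0 < c0 \/ (exists i, 0 < c i) ->
    c0 *: a + \sum_i c i *: s i = 0 ->
    exists c : 'I_m.+1 -> int,
      [/\ forall i, 0 <= c i, exists i, 0 < c i & \sum_i c i *: v i = 0].
  move=> c00 c_ge0 pos sum0.
  exists (fun i => oapp c c0 (unlift ord0 i)); split.
  - by move=> i; case: (unlift ord0 i) => /=.
  - case: pos => [c0p|[i ci]]; first by exists ord0; rewrite unlift_none.
    by exists (lift ord0 i); rewrite liftK.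
  - rewrite big_ord_recl unlift_none /= -[RHS]sum0; congr (_ + _).
    by apply: eq_bigr => i _; rewrite liftK.
have sep (y : 'rV[int]_n) : 0 < rdot y a /\ (forall i, 0 < rdot y (s i)) ->
    exists y, forall i, 0 < rdot y (v i).
  move=> [ya ys]; exists y => i; case: (unliftP ord0 i) => [j ->|->] //.
  exact: ys.
have [a0|a0] := eqVneq a 0.
  right; apply: (dep 1 (fun=> 0)) => //; first by left.
  by rewrite a0 scaler0 add0r big1 // => i _; rewrite scale0r.
have [[y ys]|[c [c0 cp cs]]] := IH s; last first.
  by right; apply: (dep 0 c) => //; [right | rewrite scale0r add0r].
have [ya|ya|ya] := ltrgt0P (rdot y a); first by left; apply: (sep y).
- have [[z zt]|[c [c0 [i ci] cs]]] :=
    IH (fun i => rdot y (s i) *: a - rdot y a *: s i).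
    (* y' is orthogonal to a, and y'.s_i is the value of z on the i-th projection, hence
       positive. *)
    left; pose y' := rdot z a *: y - rdot y a *: z.
    have [|i|z' zP] := @perturb_separator _ y' a s a0; last exact: (sep z').
    + by rewrite rdotBl !rdotZl mulrC subrr.
    + by have := zt i; rewrite rdotBl rdotBr !rdotZl !rdotZr mulrC.
  right; apply: (dep (\sum_i c i * rdot y (s i)) (fun i => c i * - rdot y a)).
  + by apply: sumr_ge0 => j _; rewrite mulr_ge0 // ltW.
  + by move=> j; rewrite mulr_ge0 // oppr_ge0 ltW.
  + by right; exists i; rewrite mulr_gt0 // oppr_gt0.
  + rewrite -[RHS]cs scaler_suml -big_split; apply: eq_bigr => j _ /=.
    by rewrite scalerBr !scalerA mulrN scaleNr.
- by have [z zP] := perturb_separator a0 ya ys; left; apply: (sep z).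
Qed.

End Gordan.

(** * Rational cones: halfspace sections, separators, dual interior *)

Section Cones.
Variables (R : realType) (n : nat).
Implicit Types (s t : seq 'rV[R]_n) (u v : 'rV[R]_n).

Lemma rdot_toR (x y : 'rV[int]_n) :
  rdot (toR R x) (toR R y) = (rdot x y)%:~R.
Proof. by rewrite /rdot rmorph_sum; apply: eq_bigr => i _; rewrite !mxE rmorphM. Qed.

Lemma toR_eq0 (x : 'rV[int]_n) : toR R x = 0 -> x = 0.
Proof.
move=> /rowP x0; apply/rowP => i; have := x0 i; rewrite !mxE.
by move=> /eqP; rewrite intr_eq0 => /eqP.
Qed.

Lemma cone_gen0 s : cone_gen s 0.
Proof.
by exists (fun=> 0) => //; rewrite big1 // => i _; rewrite scale0r.
Qed.

Lemma cone_genD s u v : cone_gen s u -> cone_gen s v -> cone_gen s (u + v).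
Proof.
move=> [c c0 ->] [d d0 ->]; exists (fun i => c i + d i) => [i|].
  exact: addr_ge0.
by rewrite -big_split; apply: eq_bigr => i _; rewrite scalerDl.
Qed.

Lemma cone_genZ s k u : 0 <= k -> cone_gen s u -> cone_gen s (k *: u).
Proof.
move=> k0 [c c0 ->]; exists (fun i => k * c i) => [i|]; first exact: mulr_ge0.
by rewrite scaler_sumr; apply: eq_bigr => i _; rewrite scalerA.
Qed.

Lemma cone_gen_sum s (I : finType) (P : pred I) (F : I -> 'rV[R]_n) :
  (forall i, P i -> cone_gen s (F i)) -> cone_gen s (\sum_(i | P i) F i).
Proof. by move=> sF; elim/big_ind: _ => //; [exact: cone_gen0|exact: cone_genD]. Qed.

Lemma cone_gen_mem s u : u \in s -> cone_gen s u.
Proof.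
move=> us; have lt : (index u s < size s)%N by rewrite index_mem.
exists (fun i => (i == Ordinal lt)%:R) => [i|]; first exact: ler0n.
rewrite (bigD1 (Ordinal lt)) //= eqxx scale1r nth_index // big1 ?addr0 //.
by move=> i /negPf ->; rewrite scale0r.
Qed.

Lemma cone_gen_sub s t :
  (forall u, u \in s -> cone_gen t u) -> cone_gen s `<=` cone_gen t.
Proof.
move=> st _ [c c0 ->]; apply: cone_gen_sum => i _.
by apply: cone_genZ => //; apply: st; apply: mem_nth.
Qed.

(* One step of Fourier-Motzkin elimination: the second family consists of the
   points where the cones spanned by x and z meet the hyperplane h = 0. *)
Definition halfspace_gens (h : 'rV[int]_n) (s : seq 'rV[int]_n) :=
  [seq x <- s | 0 <= rdot h x] ++
  [seq rdot h x *: z - rdot h z *: x |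
     x <- [seq x <- s | 0 <= rdot h x], z <- [seq z <- s | rdot h z < 0]].

(** For the harder inclusion, split v into [up] and [dn], where h is nonnegative resp. negative on
    the generators, and cancel [dn] against part of [up]. *)
Lemma cone_gen_halfspace (h : 'rV[int]_n) (s : seq 'rV[int]_n) :
  cone_gen (map (@toR R n) (halfspace_gens h s)) =
  cone_gen (map (@toR R n) s) `&` [set v | 0 <= rdot (toR R h) v].
Proof.
set t := halfspace_gens h s.
have sgen x : x \in s -> cone_gen (map (@toR R n) s) (toR R x).
  by move=> xs; apply: cone_gen_mem; apply: map_f.
have tgen x : x \in t -> cone_gen (map (@toR R n) t) (toR R x).
  by move=> xt; apply: cone_gen_mem; apply: map_f.
have toRpair x z : toR R (rdot h x *: z - rdot h z *: x) =
    rdot (toR R h) (toR R x) *: toR R z - rdot (toR R h) (toR R z) *: toR R x.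
  by rewrite !rdot_toR /toR map_mxB !map_mxZ.
have tnn x : x \in t -> 0 <= rdot h x.
  rewrite mem_cat => /orP[|/allpairsP[[y z] [/= ]]].
    by rewrite mem_filter => /andP[].
  by move=> _ _ ->; rewrite rdotBr !rdotZr mulrC subrr.
apply/seteqP; split => [v tv|v [[c c0 ->] hv]].
  split.
    apply: cone_gen_sub tv => _ /mapP [x xt ->].
    move: xt; rewrite mem_cat => /orP[|/allpairsP[[y z] [/= ]]].
      by rewrite mem_filter => /andP[_ /sgen].
    rewrite !mem_filter => /andP[hy /sgen sy] /andP[hz /sgen sz] ->.
    rewrite toRpair -scaleNr !rdot_toR; apply: cone_genD; apply: cone_genZ => //.
      by rewrite ler0z.
    by rewrite oppr_ge0 lerz0 ltW.
  case: tv => c c0 -> /=; rewrite rdot_sumr; apply: sumr_ge0 => i _.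
  rewrite rdotZr mulr_ge0 //.
  have : (map (@toR R n) t)`_i \in map (@toR R n) t by rewrite mem_nth.
  by case/mapP => x xt ->; rewrite rdot_toR ler0z tnn.
set r := map (@toR R n) s in c c0 hv *.
have rE (i : 'I_(size r)) : exists2 x, x \in s & r`_i = toR R x.
  by apply/mapP; rewrite mem_nth.
pose H (i : 'I_(size r)) := rdot (toR R h) r`_i.
pose Pos := \sum_(i < size r | 0 <= H i) c i * H i.
pose Neg := \sum_(i < size r | ~~ (0 <= H i)) c i * - H i.
pose up := \sum_(i < size r | 0 <= H i) c i *: r`_i.
pose dn := \sum_(i < size r | ~~ (0 <= H i)) c i *: r`_i.
have vE : \sum_i c i *: r`_i = up + dn by rewrite (bigID (fun i : 'I_(size r) => 0 <= H i)).
have hvE : rdot (toR R h) (up + dn) = Pos - Neg.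
  rewrite rdotDr !rdot_sumr /Pos /Neg -sumrN; congr (_ + _);
  by apply: eq_bigr => i _; rewrite rdotZr // mulrN opprK.
have PN : Neg <= Pos by rewrite -subr_ge0 -hvE -vE.
have N0i (i : 'I_(size r)) : ~~ (0 <= H i) -> 0 <= c i * - H i.
  by rewrite -ltNge => Hi; rewrite mulr_ge0 // oppr_ge0 ltW.
have N0 : 0 <= Neg by apply: sumr_ge0.
have pos_gen (i : 'I_(size r)) : 0 <= H i -> cone_gen (map (@toR R n) t) r`_i.
  rewrite /H; have [x xs ->] := rE i; rewrite rdot_toR ler0z => hx.
  by apply: tgen; rewrite mem_cat mem_filter hx xs.
have up_gen : cone_gen (map (@toR R n) t) up.
  by apply: cone_gen_sum => i Hi; apply: cone_genZ => //; apply: pos_gen.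
(* If [Pos] is 0, so is [Neg], and every coefficient in [dn] vanishes. *)
rewrite vE; have [Pos0|Pos0] := eqVneq Pos 0.
  have Neg0 : Neg = 0 by apply/eqP; rewrite eq_le N0 -Pos0 PN.
  suff -> : dn = 0 by rewrite addr0.
  apply: big1 => i Hi; have /eqP := psumr_eq0P N0i Neg0 Hi.
  rewrite mulf_eq0 oppr_eq0 => /orP[/eqP ->|/eqP Hi0]; first by rewrite scale0r.
  by rewrite Hi0 lexx in Hi.
have Pos_gt0 : 0 < Pos by rewrite lt0r Pos0 (le_trans N0).
have pairs : Pos *: (up + dn) = (Pos - Neg) *: up +
    \sum_(i < size r | 0 <= H i) \sum_(j < size r | ~~ (0 <= H j))
      (c i * c j) *: (H i *: r`_j - H j *: r`_i).
  have -> : Pos *: (up + dn) = (Pos - Neg) *: up + (Pos *: dn + Neg *: up).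
    by rewrite scalerDr scalerBl (addrC (Pos *: dn)) addrA subrK.
  congr (_ + _); rewrite /Pos scaler_suml /up scaler_sumr -big_split.
  apply: eq_bigr => i _; rewrite /dn scaler_sumr /Neg scaler_suml -big_split.
  apply: eq_bigr => j _ /=; rewrite scalerBr !scalerA -scaleNr.
  by congr (_ *: _ + _ *: _); ring.
rewrite -[up + dn]scale1r -(mulVf Pos0) -scalerA pairs.
apply: cone_genZ; first by rewrite invr_ge0 ltW.
apply: cone_genD; first by apply: cone_genZ; rewrite ?subr_ge0.
apply: cone_gen_sum => i Hi; apply: cone_gen_sum => j Hj.
apply: cone_genZ; first exact: mulr_ge0.
move: Hi Hj; rewrite /H; have [x xs ->] := rE i; have [z zs ->] := rE j.
rewrite !rdot_toR !ler0z -ltNge => hx hz; rewrite -!rdot_toR -toRpair; apply: tgen.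
by rewrite mem_cat; apply/orP; right; apply: allpairs_f; rewrite mem_filter ?hx ?hz.
Qed.

(** By Gordan's alternative for the nonzero generators: a relation with c_j > 0 would put the
    opposite of r_j, hence a whole line, in the cone. *)
Lemma strongly_convex_separator (s : seq 'rV[int]_n) :
  strongly_convex (cone_gen (map (@toR R n) s)) ->
  exists y, forall x, x \in s -> x != 0 -> 0 < rdot y x.
Proof.
move=> sc; set r := [seq x <- s | x != 0].
have rP (i : 'I_(size r)) : r`_i \in s /\ r`_i != 0.
  by have /(mem_nth 0) := ltn_ord i; rewrite mem_filter => /andP[].
have [[y yr]|[c [c0 [j cj] cr]]] := gordan (fun i : 'I_(size r) => r`_i).
  exists y => x xs x0; have xr : x \in r by rewrite mem_filter x0.
  have lt : (index x r < size r)%N by rewrite index_mem.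
  by have := yr (Ordinal lt); rewrite /= nth_index.
have rgen (i : 'I_(size r)) : cone_gen (map (@toR R n) s) (toR R r`_i).
  by apply: cone_gen_mem; apply: map_f; have [] := rP i.
have cjR : 0 < (c j)%:~R :> R by rewrite ltr0z.
have neg : cone_gen (map (@toR R n) s) (- toR R r`_j).
  have -> : - toR R r`_j =
      (c j)%:~R^-1 *: \sum_(i < size r | i != j) (c i)%:~R *: toR R r`_i.
    have : \sum_(i < size r) (c i)%:~R *: toR R r`_i = 0.
      have := congr1 (@toR R n) cr; rewrite /toR map_mx0 raddf_sum => cR.
      by rewrite -[RHS]cR; apply: eq_bigr => i _ /=; rewrite map_mxZ.
    rewrite (bigD1 j) //= => /eqP; rewrite addrC addr_eq0 => /eqP ->.
    by rewrite scalerN scalerA mulVf ?scale1r // gt_eqF.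
  apply: cone_genZ; first by rewrite invr_ge0 ltW.
  by apply: cone_gen_sum => i _; apply: cone_genZ; rewrite ?ler0z.
have [_ /eqP[]] := rP j; apply: toR_eq0; apply/eqP; rewrite -memv0.
rewrite -(sc <[toR R r`_j]>%VS) ?memv_line // => v /= /vlineP [k ->].
have [k0|k0] := lerP 0 k; first exact: cone_genZ.
by rewrite -(opprK k) scaleNr -scalerN; apply: cone_genZ => //; rewrite oppr_ge0 ltW.
Qed.

(** All summands have nonnegative value under y; if their sum is 0, each summand is itself the zero
    vector. *)
Lemma cone_gen_separator (s : seq 'rV[int]_n) (y : 'rV[int]_n) v :
  (forall x, x \in s -> x != 0 -> 0 < rdot y x) ->
  cone_gen (map (@toR R n) s) v -> v = 0 \/ 0 < rdot (toR R y) v.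
Proof.
move=> ys [c c0 ->]; rewrite rdot_sumr.
set r := map (@toR R n) s in c c0 *.
have rE (i : 'I_(size r)) :
    r`_i = 0 \/ 0 < rdot (toR R y) r`_i.
  have /mapP [x xs ->] : r`_i \in r by rewrite mem_nth.
  have [->|x0] := eqVneq x 0; first by left; rewrite /toR map_mx0.
  by right; rewrite rdot_toR ltr0z ys.
have t0 (i : 'I_(size r)) : true -> 0 <= rdot (toR R y) (c i *: r`_i).
  move=> _; rewrite rdotZr mulr_ge0 //.
  by case: (rE i) => [->|/ltW //]; rewrite rdot0r.
have [sum0|?] := eqVneq (\sum_i rdot (toR R y) (c i *: r`_i)) 0; last first.
  by right; rewrite lt0r sumr_ge0 ?andbT.
left; apply: big1 => i _; have /eqP := psumr_eq0P t0 sum0 (erefl true) (i := i).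
rewrite rdotZr mulf_eq0 => /orP[/eqP ->|/eqP yr0]; first by rewrite scale0r.
by case: (rE i) => [->|]; rewrite ?scaler0 // yr0 ltxx.
Qed.

(** Membership in the dual is tested on the finitely many generators; the strict inequalities at
    nonzero ones are open in w. *)
Lemma cone_gen_dual_interior (s : seq 'rV[int]_n) (w : 'rV[R]_n) :
  (forall x, x \in s -> x != 0 -> 0 < rdot w (toR R x)) ->
  interior (dual_cone (cone_gen (map (@toR R n) s))) w.
Proof.
move=> ws; rewrite /interior /=.
apply: (@filterS _ (nbhs w) _ [set v | forall x, x \in s -> 0 <= rdot v (toR R x)]).
  move=> v vs u [c c0 ->]; rewrite -[dotp _ _]/(rdot _ _) rdot_sumr.
  apply: sumr_ge0 => i _; rewrite rdotZr mulr_ge0 //.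
  have /mapP [x xs ->] : (map (@toR R n) s)`_i \in map (@toR R n) s by rewrite mem_nth.
  exact: vs.
elim: s ws => [|x s IH] ws; first by apply: filterE => v x.
have near_s : \forall v \near w, forall x, x \in s -> 0 <= rdot v (toR R x).
  by apply: IH => z zs; apply: ws; rewrite inE zs orbT.
have near_x : \forall v \near w, 0 <= rdot v (toR R x).
  have [->|x0] := eqVneq x 0.
    by apply: filterE => v; rewrite /toR map_mx0 rdot0r.
  have cont : continuous (fun v : 'rV[R]_n => rdot v (toR R x)).
    apply: continuous_big => [|i _ v]; first exact: add_continuous.
    apply: (@cvgM _ _ (nbhs v)); first exact: (@coord_continuous _ _ _ 0 i v).
    exact: cvg_cst.
  have wx : 0 < rdot w (toR R x) by apply: ws => //; rewrite mem_head.
  by near=> v; apply: ltW; near: v; apply: (cvgr_gt _ (cont w)).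
near=> v => z; rewrite inE => /orP[/eqP ->|]; first by near: v.
by move: z; near: v.
Unshelve. all: by end_near. Qed.

End Cones.

(** * The valuation [nu] *)

Section Nu.
Variables (R : realType) (K : fieldType) (n : nat).

(** The weight takes integer values, so the lower bound makes the minimum exist and [nu] does not
    fall back on its default 0. *)
Lemma nu_le_dot (w : 'rV[int]_n) (eta : laurent K n) (lb : int) a :
  (forall b, eta b != 0 -> lb <= rdot w b) -> eta a != 0 ->
  nu (toR R w) eta <= (rdot w a)%:~R.
Proof.
move=> etalb eta_a.
have [|e etae min] := @int_attains_min _ [set b | eta b != 0] (rdot w) lb _ etalb.
  by exists a.
rewrite /nu; set values := [set _ | _ in _].
have [|_ h] := @xgetPex _ 0 (values `&` lbound values).
  exists (rdot w e)%:~R; split; first by exists e => //; apply: rdot_toR.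
  move=> _ [b etab <-]; rewrite -[dotp _ _]/(rdot _ _) rdot_toR ler_int.
  exact: min.
by apply: h; exists a => //; apply: rdot_toR.
Qed.

Lemma nu_lmono (w : 'rV[R]_n) (b : 'rV[int]_n) :
  nu w (lmono K b) = dotp w (toR R b).
Proof.
rewrite /nu; set values := [set _ | _ in _].
have valuesE : values = [set dotp w (toR R b)].
  apply/seteqP; split => [_ [a + <-]|_ ->].
    by rewrite /supp /lmono /=; case: (a =P b) => [->|_ /eqP].
  by exists b => //; rewrite /supp /lmono /= eqxx oner_neq0.
have [|] := @xgetPex _ 0 (values `&` lbound values); rewrite valuesE //.
by exists (dotp w (toR R b)); split => // _ ->.
Qed.

End Nu.

(** * Choice of the weights and the cone, and conclusion *)

Theorem theorem7p4 (R : realType) (K : fieldType) (n : nat)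
    (charK : [pchar K] =i pred0)
    (sigma : set 'rV[R]_n)
    (sigma_rat : rational_cone sigma)
    (sigma_sc : strongly_convex sigma)
    (sigma_orth : orthant R n `<=` sigma)
    (xi : laurent K n)
    (xi_sigma : cone_series_loc sigma xi)
    (xi_not_orth : ~ cone_series_loc (orthant R n) xi)
    (xi_alg : algebraic_over_power_series R xi) :
  exists sigma' : set 'rV[R]_n,
    [/\ rational_cone sigma', strongly_convex sigma', sigma' `<=` sigma,
        orthant R n `<=` sigma' & cone_series_loc sigma' xi] /\
    exists2 w : 'rV[R]_n, interior (dual_cone sigma') w &
    exists b : R,
      forall (g : laurent K n) (beta : 'rV[int]_n),
        cone_series (orthant R n) g -> (forall i, 0 <= beta 0 i) ->
        nu w (xi \- ldivX g beta) <= dotp w (toR R beta) + b /\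
        abs_nu w (xi \- ldivX g beta) >= expR (- b) * abs_nu w (lmono K beta).
Proof.
have [d [P [P_orth P_neq0 P_root]]] := xi_alg.
have orthZ a : orthant R n (toR R a) -> forall j, 0 <= a 0 j.
  by move=> a0 j; have := a0 j; rewrite mxE ler0z.
have P_ge0 i a : P i a != 0 -> forall j, 0 <= a 0 j.
  by move=> /P_orth; apply: orthZ.
have [D P_top [p P_p]] : exists2 D : 'I_d.+1,
    forall i : 'I_d.+1, (D < i)%N -> forall a, P i a = 0 &
    exists p, P D p != 0.
  have [i0 i0P] := P_neq0.
  pose Q (i : 'I_d.+1) := `[<exists a, P i a != 0>].
  have Qi0 : Q i0 by apply/asboolP.
  have [D /asboolP QD maxD] := arg_maxnP (fun i : 'I_d.+1 => i : nat) Qi0.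
  exists D => // i Di a; apply/eqP/negPn/negP => Pia.
  have /maxD : Q i by apply/asboolP; exists a.
  by rewrite /= leqNgt Di.
have [s sE] := sigma_rat; subst sigma.
have [w1 w1s] := strongly_convex_separator sigma_sc.
have sep v := @cone_gen_separator R n s w1 v w1s.
have w1_gt0 j : 0 < w1 0 j.
  have /sigma_orth/sep[/toR_eq0/rowP/(_ j)|] :
      orthant R n (toR R (delta_mx 0 j)).
  - by move=> i; rewrite !mxE ler0z.
  - by rewrite !mxE !eqxx.
  - by rewrite rdot_toR ltr0z rdotC rdot_delta.
have [c xi_c] := xi_sigma.
(* The absolute values absorb the translation c, and p >= 0 is added to get q >= p. *)
pose q : 'rV[int]_n := \row_j (`|c 0 j| + p 0 j).
have p_le_q j : p 0 j <= q 0 j by rewrite mxE lerDr.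
have xi_q a : xi a != 0 -> cone_gen (map (@toR R n) s) (toR R (a + q)).
  move=> /xi_c ac; rewrite -(subrK c a) -addrA /toR map_mxD.
  apply: cone_genD => //; apply: sigma_orth => j; rewrite !mxE ler0z.
  by rewrite addrA addr_ge0 ?(P_ge0 _ _ P_p) // -lerBlDl sub0r ler_normr lexx orbT.
have [a1 xi_a1 [j0 a1_j0]] :
    exists2 a, xi a != 0 & exists j, (a + q) 0 j < 0.
  apply: contrapT => nex; apply: xi_not_orth; exists (- q) => a xia j.
  rewrite opprK mxE ler0z leNgt; apply/negP => aj.
  by apply: nex; exists a => //; exists j.
(* M exceeds the coordinate sum of a1 + q, whose entry at j0 is at most -1; so [w2] is negative
   there. *)
pose M : int := 1 + \sum_j `|(a1 + q) 0 j|.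
have M_gt0 : 0 < M by rewrite ltr_pwDl // sumr_ge0.
pose w2 : 'rV[int]_n := const_mx 1 + M *: delta_mx 0 j0.
have w2_gt0 j : 0 < w2 0 j.
  by rewrite !mxE ltr_pwDl // mulr_ge0 ?(ltW M_gt0) //; case: (_ && _).
have w2_a1 : rdot w2 (a1 + q) < 0.
  rewrite rdotDl rdotZl rdot_delta rdot_const1.
  have : \sum_j (a1 + q) 0 j < M.
    by rewrite /M ltr_pwDl // ler_sum // => j _; rewrite ler_norm.
  by move: (\sum_j _) ((a1 + q) 0 j0) a1_j0 => x y; move: M_gt0; nia.
pose U : int := \sum_j `|2 * w1 0 j - w2 0 j|.
have U0 : 0 <= U by apply: sumr_ge0.
pose N : nat := (4 * D.+1 * `|U|.+1)%N.
pose h (t : nat) : 'rV[int]_n := (N%:Z - t%:Z) *: w1 + t%:Z *: w2.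
have hS t : h t.+1 = h t - w1 + w2.
  by apply/rowP => j; rewrite !mxE -(addn1 t) PoszD; ring.
pose neg t := exists2 a, xi a != 0 & rdot (h t) (a + q) < 0.
have neg_N : `[<neg N>].
  apply/asboolP; exists a1 => //.
  by rewrite /h subrr scale0r add0r rdotZl pmulr_rlt0.
have neg_ex : exists t, `[<neg t>] by exists N.
(* Take the first index with a negative value; it is not 0, as [h 0] is a multiple of w1. *)
have [t [a0 xi_a0 w'_a0] [tN nneg_t]] : exists2 t, neg t.+1 & (t < N)%N /\ ~ neg t.
  case: (ex_minnP neg_ex) => [[|t] /asboolP neg_t min].
    case: neg_t => a /xi_q; rewrite /h subr0 scale0r addr0 rdotZl => /sep[].
      by move=> /toR_eq0 ->; rewrite rdot0r mulr0.
    by rewrite rdot_toR ltr0z => ? ; rewrite pmulr_rlt0 // ltNge ltW.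
  exists t => //; split; first exact: min.
  by move=> /asboolP/min; rewrite ltnn.
have ht_ge0 a : xi a != 0 -> 0 <= rdot (h t) (a + q).
  by move=> xia; rewrite leNgt; apply/negP => ha; apply: nneg_t; exists a.
have hE k j : h k 0 j = (N%:Z - k%:Z) * w1 0 j + k%:Z * w2 0 j by rewrite !mxE.
have h_pos j : 0 <= h t 0 j.
  by rewrite hE addr_ge0 // mulr_ge0 ?(ltW (w1_gt0 j)) ?(ltW (w2_gt0 j)) //;
    rewrite subr_ge0 lez_nat ltnW.
have w'_N j : N%:Z <= h t.+1 0 j.
  rewrite hE -[leLHS](subrK t.+1%:Z) -[X in X + _ <= _]mulr1.
  rewrite -[X in _ + X <= _]mulr1; apply: lerD; apply: ler_wpM2l => //.
  - by rewrite subr_ge0 lez_nat.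
  - by rewrite -gtz0_ge1.
  - by rewrite -gtz0_ge1.
(* Adding w1 makes the weight strictly positive on the nonzero vectors of the new cone. *)
pose w := h t + w1.
have w_gt0 j : 0 < w 0 j by rewrite mxE ltr_wpDl.
have w_close j : (4 * D.+1)%:Z * `|w 0 j - h t.+1 0 j| <= h t.+1 0 j.
  apply: le_trans (w'_N j).
  have -> : w 0 j - h t.+1 0 j = 2 * w1 0 j - w2 0 j.
    by rewrite /w hS !mxE; ring.
  rewrite /N (PoszM (4 * D.+1)) ler_wpM2l //.
  apply: (@le_trans _ _ U); last by rewrite -(addn1 `|U|) PoszD gez0_abs ?lerDl.
  by rewrite /U (bigD1 j) //= lerDl sumr_ge0.
have w1_q a : xi a != 0 -> 0 <= rdot w1 (a + q).
  move=> /xi_q/sep[/toR_eq0 ->|]; first by rewrite rdot0r.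
  by rewrite rdot_toR ltr0z => /ltW.
have xi_w a : xi a != 0 -> 0 <= rdot w (a + q).
  by move=> xia; rewrite rdotDl addr_ge0 ?ht_ge0 ?w1_q.
have [|b bP] := support_leaves_orthants P_ge0 P_root P_top P_p p_le_q w_gt0
  _ w_close xi_w xi_a0 w'_a0.
  by move=> j; apply: lt_le_trans (w'_N j).
have coneE := cone_gen_halfspace R (h t) s.
exists (cone_gen (map (@toR R n) (halfspace_gens (h t) s))).
have sub : cone_gen (map (@toR R n) (halfspace_gens (h t) s)) `<=`
    cone_gen (map (@toR R n) s) by rewrite coneE => v [].
split.
  split => //.
  - by exists (halfspace_gens (h t) s).
  - by move=> V Vs; apply: sigma_sc; apply: subset_trans sub.
  - rewrite coneE => v v0; split; first exact: sigma_orth.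
    by apply: rdot_ge0 => // j; rewrite mxE ler0z.
  - exists (- q) => a xia; rewrite opprK coneE; split; first exact: xi_q.
    by rewrite /= rdot_toR ler0z ht_ge0.
exists (toR R w).
  apply: cone_gen_dual_interior => x xs x0; rewrite rdot_toR ltr0z rdotDl.
  have : cone_gen (map (@toR R n) (halfspace_gens (h t) s)) (toR R x).
    by apply: cone_gen_mem; apply: map_f.
  rewrite coneE => -[/sep[/toR_eq0 x0'|]]; first by rewrite x0' eqxx in x0.
  by rewrite /= !rdot_toR ltr0z ler0z => ? ?; rewrite ltr_wpDl.
exists b%:~R => g beta g_orth beta0.
have le_nu : nu (toR R w) (xi \- ldivX g beta) <= dotp (toR R w) (toR R beta) + b%:~R.
  have [a [xia [j aj] wa]] := bP beta beta0.
  rewrite -[dotp _ _]/(rdot _ _) rdot_toR -intrD.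
  apply: (@le_trans _ _ (rdot w a)%:~R); last by rewrite ler_int.
  have g_ge0 y : g y != 0 -> forall i, 0 <= y 0 i by move=> /g_orth; apply: orthZ.
  have w_ge0 j' : 0 <= w 0 j' by apply: ltW.
  (* On the support of xi the weight is at least - w.q, on that of g / x^beta at least - w.beta. *)
  apply: (@nu_le_dot _ _ _ _ _ (- rdot w q - rdot w beta)).
    have wq0 : 0 <= rdot w q.
      apply: rdot_ge0 => // i; apply: le_trans (p_le_q i); exact: P_ge0 P_p i.
    have wb0 : 0 <= rdot w beta by apply: rdot_ge0.
    move=> y; rewrite /= ldivXE; have [xiy|xiy _] := eqVneq (xi y) 0.
      rewrite xiy sub0r oppr_eq0 => /g_ge0 gy.
      rewrite lerBlDr -rdotDr; apply: le_trans (rdot_ge0 w_ge0 gy).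
      by rewrite oppr_le0.
    rewrite addrC lerBlDr -rdotDr; apply: le_trans (xi_w _ xiy).
    by rewrite oppr_le0.
  (* The j-th entry of a + beta is negative, so g / x^beta has no term at a to cancel that of xi. *)
  rewrite /= ldivXE; suff -> : g (a + beta) = 0 by rewrite subr0.
  apply/eqP/negPn/negP => /g_ge0 /(_ j).
  by rewrite mxE leNgt -ltrBrDr sub0r aj.
split => //.
by rewrite /abs_nu nu_lmono -expRD ler_expR -opprD lerN2 addrC.
Qed.
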